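(* Suppose that we have a $k$-th order system of two rational difference equations $$x_n=\frac{\alpha+\sum^{k}_{i=1}\beta_{i}x_{n-i} + \sum^{k}_{i=1}\gamma_{i}y_{n-i}}{A+\sum^{k}_{j=1}B_{j}x_{n-j} + \sum^{k}_{j=1}C_{j}y_{n-j}},\qquad y_n=\frac{p+\sum^{k}_{i=1}\delta_{i}x_{n-i} + \sum^{k}_{i=1}\epsilon_{i}y_{n-i}}{q+\sum^{k}_{j=1}D_{j}x_{n-j} + \sum^{k}_{j=1}E_{j}y_{n-j}},\qquad n\in\mathbb{N},$$ with non-negative parameters and non-negative initial conditions. Also suppose that $\{y_n\}_{n=1}^\infty$ is bounded above, that $A>0$, and that there exists a positive integer $\eta$ such that for every sequence $\{c_m\}_{m=1}^\infty$ with $c_m\in I_\beta$ for $m=1,2,\dots$ there exist positive integers $N_1,N_2\le\eta$ such that $\sum_{m=N_1}^{N_2}c_m\in I_B$. Then there exist $M>0$ and $N\in\mathbb{N}$ so that, given any non-negative initial conditions, we have $x_n\le M$ for all $n>N$.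
   Context: $\mathbb{N}=\{1,2,\dots\}$ and $k$ is a positive integer. Initial conditions are $x_{1-k},\dots,x_0,y_{1-k},\dots,y_0\ge 0$, taken so that the denominators do not vanish. Index sets in $\{1,\dots,k\}$: $I_\beta=\{i:\beta_i>0\}$, $I_B=\{j:B_j>0\}$. *)

(* Defs.v *)
From HB Require Import structures.
From mathcomp Require Import all_boot all_order all_algebra.
From mathcomp Require Import reals.
Set Implicit Arguments.
Unset Strict Implicit.
Unset Printing Implicit Defensive.
Import Order.TTheory GRing.Theory Num.Theory.
Local Open Scope ring_scope.

(* Coefficient families are functions nat -> R of which only the values at
   1, ..., k matter; sequences are functions int -> R of which only the values
   at indices >= 1 - k matter. *)

Definition lagform (R : realType) (k : nat) (a : R) (b c : nat -> R)
    (x y : int -> R) (n : int) : R :=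
  a + \sum_(1 <= i < k.+1) b i * x (n - i%:Z)
    + \sum_(1 <= i < k.+1) c i * y (n - i%:Z).

(* I_b = {i in {1, ..., k} : b_i > 0} *)
Definition posIndex (R : realType) (k : nat) (b : nat -> R) : pred nat :=
  [pred i | (1 <= i <= k)%N && (0 < b i)].

Definition nonnegCoefs (R : realType) (k : nat) (b : nat -> R) : Prop :=
  forall i : nat, (1 <= i <= k)%N -> 0 <= b i.

(* The solutions correspond to the non-negative initial conditions for which
   no denominator vanishes; since division by 0 is total, the non-vanishing
   has to be required explicitly. *)
Definition isSolution (R : realType) (k : nat)
    (alpha : R) (beta gamma : nat -> R) (A : R) (B C : nat -> R)
    (p : R) (delta epsilon : nat -> R) (q : R) (D E : nat -> R)
    (x y : int -> R) : Prop :=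
  (forall n : int, 1 - k%:Z <= n <= 0 -> 0 <= x n /\ 0 <= y n) /\
  (forall n : int, 1 <= n ->
     [/\ lagform k A B C x y n != 0,
         lagform k q D E x y n != 0,
         x n = lagform k alpha beta gamma x y n / lagform k A B C x y n &
         y n = lagform k p delta epsilon x y n / lagform k q D E x y n]).

(* Main.v *)
(* Let L n >= A be the denominator of x n. Bounding the y-terms and dividing by
   A gives x n <= a + sum_i beta_i x (n - i) / L n once n > k. Iterating this
   inequality expands x n into a tree whose branches are sequences of indices
   in I_beta; a branch stops as soon as some terminal segment of it has sum j
   in I_B, because L t >= B_j x (t - j), t being the time at which the segment
   starts, bounds its contribution by a constant. By the hypothesis on paths
   every branch stops within depth eta, so the tree is finite and its size does
   not depend on n or on the solution. *)
Require Import Defs.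
From HB Require Import structures.
From mathcomp Require Import all_boot all_order all_algebra.
From mathcomp Require Import boolp reals zify ring lra.
Set Implicit Arguments.
Unset Strict Implicit.
Unset Printing Implicit Defensive.
Import Order.TTheory GRing.Theory Num.Theory.
Local Open Scope ring_scope.

(** * Majorized recursions and weights of paths *)

(** Only this inequality is iterated: [a] absorbs the y-terms and [L] stands for the denominator. It
    starts at [k < n], where every lagged index is positive. *)
Definition dominated (R : realType) (k : nat) (beta B : nat -> R) (A a : R)
    (x L : int -> R) : Prop :=
  (forall n : int, 1 <= n -> 0 <= x n) /\
  (forall n : int, k%:Z < n ->
     [/\ A <= L n,
         forall j, j \in posIndex k B -> B j * x (n - j%:Z) <= L n &
         x n <= a + \sum_(1 <= i < k.+1) beta i / L n * x (n - i%:Z)]).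

(* Coefficient of x (n - sumn l) after substituting the recursive upper bound
   for x successively at the times n, n - l_1, n - l_1 - l_2, ... *)
Fixpoint pathWeight (R : realType) (beta : nat -> R) (L : int -> R) (n : int)
    (l : seq nat) : R :=
  if l is i :: l' then beta i / L n * pathWeight beta L (n - i%:Z) l' else 1.

Lemma pathWeight_cat (R : realType) (beta : nat -> R) (L : int -> R) (n : int)
    (l1 l2 : seq nat) :
  pathWeight beta L n (l1 ++ l2) =
  pathWeight beta L n l1 * pathWeight beta L (n - (sumn l1)%:Z) l2.
Proof.
elim: l1 n => [|i l1 IH] n /=; first by rewrite subr0 mul1r.
by rewrite IH mulrA PoszD opprD addrA.
Qed.

(** Since [k + sumn l < n], every time met along the path exceeds [k], so each denominator is at
    least [A]. *)
Lemma pathWeight_bounds (R : realType) (k : nat) (beta : nat -> R) (A : R)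
    (L : int -> R) (n : int) (l : seq nat) :
  0 < A -> (forall m : int, k%:Z < m -> A <= L m) ->
  {in l, forall i, 0 <= beta i} -> (k + sumn l)%:Z < n ->
  0 <= pathWeight beta L n l <= \prod_(i <- l) (beta i / A).
Proof.
move=> A0 LA; elim: l n => [|i l IH] n b0 /= ln; first by rewrite big_nil ler01 lexx.
have nk : k%:Z < n by lia.
have /andP[w0 w1] : 0 <= pathWeight beta L (n - i%:Z) l <= \prod_(j <- l) (beta j / A).
  apply: IH; last by lia.
  by move=> j jl; apply: b0; rewrite inE jl orbT.
have bi : 0 <= beta i by apply: b0; rewrite mem_head.
have Ln0 : 0 < L n := lt_le_trans A0 (LA n nk).
have q0 : 0 <= beta i / L n by rewrite divr_ge0 // ltW.
rewrite big_cons mulr_ge0 //=; apply: ler_pM => //.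
by rewrite ler_wpM2l // lef_pV2 ?posrE // LA.
Qed.

Lemma posIndex_gt0 (R : realType) (k : nat) (b : nat -> R) (i : nat) :
  i \in posIndex k b -> 0 < b i.
Proof. by rewrite inE => /andP[]. Qed.

Lemma posIndex_le (R : realType) (k : nat) (b : nat -> R) (i : nat) :
  i \in posIndex k b -> (i <= k)%N.
Proof. by rewrite inE => /andP[/andP[]]. Qed.

Lemma posIndex0 (R : realType) (k : nat) (b : nat -> R) :
  (0 \in posIndex k b) = false.
Proof. by rewrite inE. Qed.

(* At the time t where the segment l2 starts, the denominator L t contains
   B_j x (t - j) with j = sumn l2, which cancels the growth of x (t - j). *)
Lemma suffix_bound (R : realType) (k : nat) (beta B : nat -> R) (A a : R)
    (x L : int -> R) (n : int) (l1 l2 : seq nat) :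
  0 < A -> dominated k beta B A a x L ->
  {in l1 ++ l2, forall i, 0 <= beta i} -> sumn l2 \in posIndex k B ->
  (k + sumn (l1 ++ l2))%:Z < n ->
  pathWeight beta L n (l1 ++ l2) * x (n - (sumn (l1 ++ l2))%:Z) <=
  \prod_(i <- l1) (beta i / A) *
    (beta (head 0 l2) * \prod_(i <- behead l2) (beta i / A) / B (sumn l2)).
Proof.
move=> A0 [x0 dom] b0 hit; rewrite sumn_cat => ln.
have LA m : k%:Z < m -> A <= L m by move=> /dom[].
case: l2 b0 hit ln => [|i l2] b0 hit ln; first by rewrite posIndex0 in hit.
rewrite pathWeight_cat -mulrA /=.
set t := n - (sumn l1)%:Z.
have -> : n - (sumn l1 + (i + sumn l2))%N%:Z = t - (i + sumn l2)%N%:Z.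
  by rewrite /t PoszD opprD addrA.
have nt : (k + (i + sumn l2))%:Z < t by rewrite /t /= in ln *; lia.
have tk : k%:Z < t by lia.
have /andP[w0 w1] :
    0 <= pathWeight beta L n l1 <= \prod_(j <- l1) (beta j / A).
  apply: pathWeight_bounds LA _ _ => //; last by lia.
  by move=> j jl; apply: b0; rewrite mem_cat jl.
have /andP[v0 v1] :
    0 <= pathWeight beta L (t - i%:Z) l2 <= \prod_(j <- l2) (beta j / A).
  apply: pathWeight_bounds LA _ _ => //; last by lia.
  by move=> j jl; apply: b0; rewrite mem_cat inE jl !orbT.
have bi : 0 <= beta i by apply: b0; rewrite mem_cat mem_head orbT.
have Lt0 : 0 < L t := lt_le_trans A0 (LA t tk).
have B0 := posIndex_gt0 hit.
have [_ /(_ _ hit) BL _] := dom t tk.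
have xt0 : 0 <= x (t - (i + sumn l2)%N%:Z) by apply: x0; lia.
apply: ler_pM => //; first by rewrite !mulr_ge0 // invr_ge0 ltW.
(* The factor [1 / L t] of the segment's first step is paired with [x (t - j)], their product being
   at most [1 / B j]; hence [beta i] is left undivided by [A]. *)
rewrite [leLHS](_ : _ = beta i * (pathWeight beta L (t - i%:Z) l2 *
  (x (t - (i + sumn l2)%N%:Z) / L t))); last by ring.
rewrite -[leRHS]mulrA.
rewrite ler_wpM2l //; apply: ler_pM => //; first by rewrite divr_ge0 // ltW.
by rewrite ler_pdivrMr // mulrC ler_pdivlMr // mulrC.
Qed.

(** * The tree of paths and its finite depth *)

Lemma sumn_le_size (k : nat) (l : seq nat) :
  {in l, forall i, (i <= k)%N} -> (sumn l <= k * size l)%N.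
Proof.
elim: l => //= i l IH lk; rewrite mulnS leq_add ?lk ?mem_head //.
by apply: IH => j jl; apply: lk; rewrite inE jl orbT.
Qed.

(** Lists are indexed from 0 and the sequences of the hypothesis from 1, hence [m.-1]. If [N2 < N1],
    both the sum and the infix are empty. *)
Lemma sum_nth_infix (x0 : nat) (l : seq nat) (N1 N2 : nat) :
  (0 < N1)%N -> (N2 <= size l)%N ->
  exists2 s, infix s l & (\sum_(N1 <= m < N2.+1) nth x0 l m.-1)%N = sumn s.
Proof.
case: N1 => // N1 _ N2l; exists (take (N2 - N1) (drop N1 l)).
  exact: infix_trans (infix_take _ _) (infix_drop _ _).
rewrite big_add1 /= -(map_nth_iota x0) ?leq_sub2r //.
by rewrite sumnE big_map.
Qed.

(** Induction on the remaining depth [d], from the leaves to the root; [l] is a branch that has not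
    stopped yet. Choosing [M] before [x], [L] and [n] makes the bound uniform. *)
Lemma path_bound (R : realType) (k : nat) (beta B : nat -> R) (A a : R)
    (eta d : nat) (l : seq nat) :
  nonnegCoefs k beta -> 0 < A -> 0 <= a -> (0 < eta)%N ->
  (forall c : nat -> nat,
     (forall m : nat, (1 <= m)%N -> c m \in posIndex k beta) ->
     exists N1 N2 : nat,
       [/\ (1 <= N1 <= eta)%N, (1 <= N2 <= eta)%N &
           (\sum_(N1 <= m < N2.+1) c m)%N \in posIndex k B]) ->
  (size l + d)%N = eta -> {in l, forall i, i \in posIndex k beta} ->
  (forall s, infix s l -> sumn s \notin posIndex k B) ->
  exists M : R, forall x L, dominated k beta B A a x L ->
    forall n : int, (k * eta + k)%:Z < n ->
    pathWeight beta L n l * x (n - (sumn l)%:Z) <= M.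
Proof.
move=> beta0 A0 a0 eta0 paths; elim: d l => [|d IH] l sz lb nohit.
  rewrite addn0 in sz.
  (* No branch of length [eta] is left: continued by repeating its head, it would be a sequence in
     [I_beta] whose segment with sum in [I_B] lies inside [l], as [N2 <= eta]. *)
  have [|N1 [N2 [/andP[N1p _] /andP[_ N2l] hit]]] :=
      paths (fun m => nth (head 0%N l) l m.-1).
    move=> m _; apply: lb.
    case: (ltnP m.-1 (size l)) => h; first exact: mem_nth.
    rewrite nth_default //; case: (l) sz eta0 => [<- //|i l' _ _].
    exact: mem_head.
  have [|s sl es] := @sum_nth_infix (head 0%N l) l N1 N2 N1p; first by rewrite sz.
  by rewrite es (negPf (nohit _ sl)) in hit.
have /choice[Mf MfP] : forall i, exists Mi : R, i \in posIndex k beta ->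
    forall x L, dominated k beta B A a x L ->
    forall n : int, (k * eta + k)%:Z < n ->
    pathWeight beta L n (rcons l i) * x (n - (sumn (rcons l i))%:Z) <= Mi.
  move=> i; have [ib|nib] := boolP (i \in posIndex k beta); last by exists 0.
  have lib : {in rcons l i, forall j, j \in posIndex k beta}.
    by move=> j; rewrite mem_rcons inE => /predU1P[->//|/lb].
  (* An infix of [rcons l i] is a suffix of it or an infix of [l], so only suffixes can newly hit
     [I_B]. On a hit the branch stops; otherwise the induction goes one level deeper. *)
  have [[s /suffixP[l1 el] hit]|nosuf] :=
      EM (exists2 s, suffix s (rcons l i) & sumn s \in posIndex k B).
    eexists => _ x L dom n hn; rewrite el.
    apply: (suffix_bound A0 dom) => //; rewrite -el.
      by move=> j /lib /posIndex_gt0 /ltW.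
    have /sumn_le_size : {in rcons l i, forall j, (j <= k)%N}.
      by move=> j /lib /posIndex_le.
    rewrite size_rcons => h.
    have : (k * (size l).+1 <= k * eta)%N by rewrite leq_mul2l; lia.
    by lia.
  have [||M MP] := IH (rcons l i) _ lib _; last by exists M.
    by rewrite size_rcons; lia.
  move=> s; rewrite infix_rconsl => /orP[ss|/nohit//].
  by apply/negP => hs; apply: nosuf; exists s.
(* Substituting once more at time [n - sumn l], the constant [a] carries the weight of [l], and each
   [i] with [0 < beta i] gives the child [rcons l i]. *)
exists (\prod_(i <- l) (beta i / A) * a +
        \sum_(1 <= i < k.+1) if 0 < beta i then Mf i else 0).
move=> x L dom n hn.
have [x0 dom'] := dom.
have sl : (sumn l <= k * eta)%N.
  apply: (@leq_trans (k * size l)); last by rewrite leq_mul2l; lia.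
  by apply: sumn_le_size => j /lb /posIndex_le.
have LA m : k%:Z < m -> A <= L m by move=> /dom'[].
have /andP[w0 w1] : 0 <= pathWeight beta L n l <= \prod_(j <- l) (beta j / A).
  apply: pathWeight_bounds LA _ _ => //; last by lia.
  by move=> j /lb /posIndex_gt0 /ltW.
have [|_ _ xn] := dom' (n - (sumn l)%:Z); first by lia.
apply: le_trans (ler_wpM2l w0 xn) _; rewrite mulrDr lerD ?ler_wpM2r //.
rewrite mulr_sumr !big_nat; apply: ler_sum => i ik.
have ik' : (1 <= i <= k)%N by [].
case: ifPn => [bi|]; last first.
  rewrite lt_neqAle beta0 // andbT negbK => /eqP <-.
  by rewrite !mul0r mulr0.
have ib : i \in posIndex k beta by rewrite inE bi andbT.
have := MfP i ib x L dom n hn.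
rewrite -cats1 pathWeight_cat sumn_cat /= addn0 mulr1 PoszD opprD addrA.
by move=> h; rewrite mulrA.
Qed.

Lemma dominated_bounded (R : realType) (k : nat) (beta B : nat -> R) (A a : R)
    (eta : nat) :
  nonnegCoefs k beta -> 0 < A -> 0 <= a -> (0 < eta)%N ->
  (forall c : nat -> nat,
     (forall m : nat, (1 <= m)%N -> c m \in posIndex k beta) ->
     exists N1 N2 : nat,
       [/\ (1 <= N1 <= eta)%N, (1 <= N2 <= eta)%N &
           (\sum_(N1 <= m < N2.+1) c m)%N \in posIndex k B]) ->
  exists M : R, forall x L, dominated k beta B A a x L ->
    forall n : int, (k * eta + k)%:Z < n -> x n <= M.
Proof.
move=> beta0 A0 a0 eta0 paths.
have [|||M MP] := @path_bound R k beta B A a eta eta [::] beta0 A0 a0 eta0 paths.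
- by [].
- by [].
- by move=> s; rewrite infixs0 => /eqP ->; rewrite posIndex0.
exists M => x L dom n hn.
by have := MP x L dom n hn; rewrite /= mul1r subr0.
Qed.

(** * From solutions of the system to the majorized recursion *)

Lemma lagform_ge0 (R : realType) (k : nat) (a : R) (b c : nat -> R)
    (x y : int -> R) (n : int) :
  0 <= a -> nonnegCoefs k b -> nonnegCoefs k c ->
  (forall i : nat, (1 <= i <= k)%N -> 0 <= x (n - i%:Z) /\ 0 <= y (n - i%:Z)) ->
  0 <= lagform k a b c x y n.
Proof.
move=> a0 b0 c0 xy0; rewrite /lagform !addr_ge0 //.
all: rewrite big_nat; apply: sumr_ge0 => i ik; have [] := xy0 i ik => *.
all: by rewrite mulr_ge0 ?b0 ?c0.
Qed.

Lemma lagform_ge_const (R : realType) (k : nat) (a : R) (b c : nat -> R)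
    (x y : int -> R) (n : int) :
  nonnegCoefs k b -> nonnegCoefs k c ->
  (forall i : nat, (1 <= i <= k)%N -> 0 <= x (n - i%:Z) /\ 0 <= y (n - i%:Z)) ->
  a <= lagform k a b c x y n.
Proof.
move=> b0 c0 xy0; have := @lagform_ge0 R k 0 b c x y n (lexx _) b0 c0 xy0.
by rewrite /lagform; lra.
Qed.

Lemma lagform_ge_term (R : realType) (k : nat) (a : R) (b c : nat -> R)
    (x y : int -> R) (n : int) (j : nat) :
  0 <= a -> nonnegCoefs k b -> nonnegCoefs k c ->
  (forall i : nat, (1 <= i <= k)%N -> 0 <= x (n - i%:Z) /\ 0 <= y (n - i%:Z)) ->
  (1 <= j <= k)%N -> b j * x (n - j%:Z) <= lagform k a b c x y n.
Proof.
move=> a0 b0 c0 xy0 jk.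
(* Deleting the [j]-th coefficient leaves a nonnegative form. *)
pose b' i := if i == j then 0 else b i.
have b'0 : nonnegCoefs k b' by move=> i ik; rewrite /b'; case: ifP => // _; exact: b0.
have := @lagform_ge0 R k a b' c x y n a0 b'0 c0 xy0; rewrite /lagform.
have -> : \sum_(1 <= i < k.+1) b i * x (n - i%:Z) =
    b j * x (n - j%:Z) + \sum_(1 <= i < k.+1) b' i * x (n - i%:Z).
  have jin : j \in index_iota 1 k.+1 by rewrite mem_index_iota.
  rewrite (bigD1_seq j) ?iota_uniq //= [in RHS](bigD1_seq j) ?iota_uniq //=.
  rewrite /b' eqxx mul0r add0r; congr (_ + _).
  by apply: eq_bigr => i /negPf ->.
by lra.
Qed.

Lemma solution_ge0 (R : realType) (k : nat)
    (alpha : R) (beta gamma : nat -> R) (A : R) (B C : nat -> R)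
    (p : R) (delta epsilon : nat -> R) (q : R) (D E : nat -> R)
    (x y : int -> R) (n : int) :
  0 <= alpha -> nonnegCoefs k beta -> nonnegCoefs k gamma ->
  0 <= A -> nonnegCoefs k B -> nonnegCoefs k C ->
  0 <= p -> nonnegCoefs k delta -> nonnegCoefs k epsilon ->
  0 <= q -> nonnegCoefs k D -> nonnegCoefs k E ->
  isSolution k alpha beta gamma A B C p delta epsilon q D E x y ->
  1 - k%:Z <= n -> 0 <= x n /\ 0 <= y n.
Proof.
move=> al0 be0 ga0 A0 B0 C0 p0 de0 ep0 q0 D0 E0 [init rec].
(* Indices start at [1 - k], so the induction runs on a natural bound for [n + k]. *)
have [m nm] : exists m : nat, n + k%:Z <= m%:Z by exists (absz (n + k%:Z)); lia.
elim: m n nm => [|m IH] n nm kn; first by lia.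
have [n0|n1] := leP n 0; first by apply: init; rewrite kn.
have n1' : 1 <= n by lia.
have past (i : nat) : (1 <= i <= k)%N -> 0 <= x (n - i%:Z) /\ 0 <= y (n - i%:Z).
  by move=> ik; apply: IH; lia.
have [_ _ -> ->] := rec n n1'.
by split; rewrite divr_ge0 // lagform_ge0.
Qed.

Theorem theorem11 (R : realType) (k : nat) (k_gt0 : (0 < k)%N)
    (alpha : R) (beta gamma : nat -> R) (A : R) (B C : nat -> R)
    (p : R) (delta epsilon : nat -> R) (q : R) (D E : nat -> R)
    (alpha_ge0 : 0 <= alpha) (beta_ge0 : nonnegCoefs k beta)
    (gamma_ge0 : nonnegCoefs k gamma)
    (A_ge0 : 0 <= A) (B_ge0 : nonnegCoefs k B) (C_ge0 : nonnegCoefs k C)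
    (p_ge0 : 0 <= p) (delta_ge0 : nonnegCoefs k delta)
    (epsilon_ge0 : nonnegCoefs k epsilon)
    (q_ge0 : 0 <= q) (D_ge0 : nonnegCoefs k D) (E_ge0 : nonnegCoefs k E)
    (y_bounded : exists K : R, forall x y : int -> R,
       isSolution k alpha beta gamma A B C p delta epsilon q D E x y ->
       forall n : int, 1 <= n -> y n <= K)
    (A_gt0 : 0 < A)
    (paths : exists eta : nat, (0 < eta)%N /\
       forall c : nat -> nat,
         (forall m : nat, (1 <= m)%N -> c m \in posIndex k beta) ->
         exists N1 N2 : nat,
           [/\ (1 <= N1 <= eta)%N, (1 <= N2 <= eta)%N &
               (\sum_(N1 <= m < N2.+1) c m)%N \in posIndex k B]) :
  exists (M : R) (N : nat),
    [/\ 0 < M, (0 < N)%N &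
        forall x y : int -> R,
          isSolution k alpha beta gamma A B C p delta epsilon q D E x y ->
          forall n : int, N%:Z < n -> x n <= M].
Proof.
have [K yK] := y_bounded; have [eta [eta0 pathsP]] := paths.
(* The absolute value keeps [a] nonnegative whatever the sign of [K]. *)
pose a := (alpha + \sum_(1 <= i < k.+1) gamma i * `|K|) / A.
have a0 : 0 <= a.
  rewrite divr_ge0 // addr_ge0 // big_nat.
  by apply: sumr_ge0 => i ik; rewrite mulr_ge0 ?gamma_ge0.
have [M MP] := dominated_bounded beta_ge0 A_gt0 a0 eta0 pathsP.
(* At most [eta] lags of size at most [k] reach back by [k * eta]; the further [k] keeps the
   recursion valid there. *)
exists (Num.max M 1), (k * eta + k)%N; split.
- by rewrite lt_max ltr01 orbT.
- by rewrite addn_gt0 k_gt0 orbT.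
move=> x y sol n hn; rewrite le_max; apply/orP; left.
apply: (MP x (lagform k A B C x y)) hn.
have xy0 m : 1 - k%:Z <= m -> 0 <= x m /\ 0 <= y m.
  by move=> km; apply: solution_ge0 sol km.
split=> [m m1|m mk]; first by have [] := xy0 m ltac:(lia).
have past (i : nat) : (1 <= i <= k)%N -> 0 <= x (m - i%:Z) /\ 0 <= y (m - i%:Z).
  by move=> ik; apply: xy0; lia.
have LA : A <= lagform k A B C x y m by exact: lagform_ge_const.
have L0 := lt_le_trans A_gt0 LA.
split=> // [j|].
  by rewrite inE => /andP[jk _]; exact: lagform_ge_term.
have [_ _ -> _] := sol.2 m ltac:(lia).
(* The beta-terms over the denominator are exactly the sum in [dominated]; the rest has to be
   bounded by [a]. *)
rewrite {1}/lagform addrAC mulrDl lerD //; last first.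
  by rewrite mulr_suml; apply: ler_sum => i _; rewrite mulrAC.
have s0 : alpha + \sum_(1 <= i < k.+1) gamma i * y (m - i%:Z) <=
    alpha + \sum_(1 <= i < k.+1) gamma i * `|K|.
  rewrite lerD2l !big_nat; apply: ler_sum => i ik.
  rewrite ler_wpM2l ?gamma_ge0 // (le_trans _ (ler_norm K)) //.
  by apply: yK sol _ _; lia.
apply: ler_pM => //.
- rewrite addr_ge0 // big_nat; apply: sumr_ge0 => i ik.
  by rewrite mulr_ge0 ?gamma_ge0 //; have [] := past i ik.
- by rewrite invr_ge0 ltW.
- by rewrite lef_pV2 ?posrE.
Qed.
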